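(* Let $m\geq 2$, let $a_i,b_i\geq 2$ be integers for $1\leq i\leq m$, and let $\{(A_i,B_i)\}_{i=1}^m$ be a $1$-cross intersecting set pair system with $|A_i|\leq a_i$ and $|B_i|\leq b_i$ for every $1\leq i\leq m$. Then $$\sum_{i=1}^m \frac{1}{\binom{a_i+b_i}{a_i}}\leq\frac{5}{6}.$$ In particular, if $a,b\geq 2$ and $\{(A_i,B_i)\}_{i=1}^m$ is a $1$-cross intersecting set pair system with $|A_i|\leq a$ and $|B_i|\leq b$ for every $i$, then $m\leq\frac{5}{6}\binom{a+b}{a}$; that is, $m(a,b,1)\leq \frac{5}{6}\binom{a+b}{a}$.
   Context: A set pair system is a family $\{(A_i,B_i)\}_{i=1}^m$ of $m\geq 2$ pairs of finite sets. It is $1$-cross intersecting if $A_i\cap B_i=\emptyset$ for all $i$ and $|A_i\cap B_j|=1$ for all distinct $i,j\in[m]$. $m(a,b,1)$ denotes the maximum size $m$ of a $1$-cross intersecting set pair system with $|A_i|\leq a$ and $|B_i|\leq b$ for all $i$. *)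

(* Defs.v *)
(* Mathematical Components, with finite sets from mathcomp-finmap. *)
From mathcomp Require Import all_boot all_order all_algebra.
From mathcomp Require Import finmap.

Set Implicit Arguments.
Unset Strict Implicit.
Unset Printing Implicit Defensive.

Local Open Scope fset_scope.

(* The pairs (A i, B i) are indexed by 'I_m = {0, ..., m-1}; requiring at least
   two pairs is part of the notion of a set pair system. *)
Definition one_cross_intersecting (K : choiceType) (m : nat)
    (A B : 'I_m -> {fset K}) : Prop :=
  [/\ 2 <= m,
      forall i, A i `&` B i = fset0
    & forall i j, i != j -> #|` A i `&` B j| = 1].

Definition has_bounded_system (a b m : nat) : Prop :=
  exists (K : choiceType) (A B : 'I_m -> {fset K}),
    one_cross_intersecting A B /\ forall i, #|` A i| <= a /\ #|` B i| <= b.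

(* M = m(a, b, 1).  The maximum is given as a relation because its existence is
   not a priori clear: the sizes have to be shown to be bounded. *)
Definition is_max_system_size (a b M : nat) : Prop :=
  has_bounded_system a b M /\ forall m, has_bounded_system a b m -> m <= M.

(* Main.v *)
Require Import Defs.
From Stdlib Require Import Classical.
From mathcomp Require Import all_boot all_order all_algebra.
From mathcomp Require Import finmap zify lra.

(* Write w(a, b) = 1 / 'C(a + b, a) and f = \sum_i w(|A i|, |B i|).  Averaging over
   the last element x of a random ordering of the ground set, f is at most
   f(S_x) for some x occurring in the system S, where S_x drops the pairs with
   x in A i and removes x from the other B i; the same holds with A and B
   exchanged.  Induction on the total size proves f <= 5/6 for systems whose
   sets have at least two elements, except that one B i may be a singleton {y}
   (then y lies in all the other A j, which makes that case easy).  The step to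
   S_x fails only if x lies in two sets B 1 = {x, y1}, B 2 = {x, y2}.  Then
   either A 1 = {y2, e} and A 2 = {y1, e}, or |A 1|, |A 2| >= 3, or
   f(S_x) <= 5/6 by a direct estimate.  The first case is bounded directly.  In
   the second case we may assume that the dual situation also occurs, and it must
   be centred at the same x: A 3 = {x, v1}, A 4 = {x, v2}.  Every other pair then
   contains x or {y1, y2} in its A and x or {v1, v2} in its B.  The direct
   estimates delete such common elements from a subfamily, apply the Bollobas
   bound f <= 1 to what remains and compare the values of w. *)

Set Implicit Arguments.
Unset Strict Implicit.
Unset Printing Implicit Defensive.

Import Order.TTheory GRing.Theory Num.Theory.
Local Open Scope ring_scope.

Implicit Types T X : finType.

(** * The weight of a pair *)

Definition wgt (a b : nat) : rat := locked ('C(a + b, a)%:R)^-1.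

Lemma wgtE a b : wgt a b = ('C(a + b, a)%:R)^-1.
Proof. by rewrite /wgt -lock. Qed.

Lemma wgtC a b : wgt a b = wgt b a.
Proof. by rewrite !wgtE [in RHS]addnC -bin_sub ?leq_addr // addKn. Qed.

Lemma wgt_gt0 a b : 0 < wgt a b.
Proof. by rewrite wgtE invr_gt0 ltr0n bin_gt0 leq_addr. Qed.

Lemma wgt_ge0 a b : 0 <= wgt a b.
Proof. exact: ltW (wgt_gt0 a b). Qed.

Lemma wgt0r a : wgt a 0 = 1.
Proof. by rewrite !wgtE addn0 binn invr1. Qed.

Lemma wgtSr a b : wgt a b.+1 = b.+1%:R / (a + b).+1%:R * wgt a b.
Proof.
have h : ('C((a + b).+1, a) * b.+1 = (a + b).+1 * 'C(a + b, a))%N.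
  by rewrite mul_bin_down subSn ?leq_addr // addKn mulnC.
rewrite !wgtE addnS -[b.+1%:R / _]invf_div -invfM; congr (_^-1).
by rewrite mulrAC -natrM -h natrM mulfK // pnatr_eq0.
Qed.

Lemma wgtSl a b : wgt a.+1 b = a.+1%:R / (a + b).+1%:R * wgt a b.
Proof. by rewrite wgtC wgtSr wgtC addnC. Qed.

Lemma wgt_le a b c d : (c <= a)%N -> (d <= b)%N -> wgt a b <= wgt c d.
Proof.
have le x y z : (z <= y)%N -> wgt x y <= wgt x z.
  move=> /subnK <-; elim: (y - z)%N => // k IH.
  apply: le_trans IH; rewrite addSn wgtSr ler_piMl ?wgt_ge0 //.
  by rewrite ler_pdivrMr ?ltr0n // mul1r ler_nat ltnS leq_addl.
move=> ca db; apply: le_trans (le _ _ _ db) _.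
by rewrite wgtC [leRHS]wgtC le.
Qed.

Lemma ler_ratio_mul (x y p q : nat) (w : rat) :
  0 <= w -> (0 < y)%N -> (0 < q)%N -> (q * x <= p * y)%N ->
  x%:R / y%:R * w <= p%:R / q%:R * w.
Proof.
move=> w0 y0 q0 h; rewrite ler_wpM2r // ler_pdivrMr ?ltr0n // mulrAC.
by rewrite ler_pdivlMr ?ltr0n // -!natrM ler_nat mulnC.
Qed.

(** The quotient is (a + 1)(b + 1) / ((a + b + 1)(a + b + 2)), which for positive arguments is
    largest at a = b = 1. Excluding that point gives the 3/10 of the next lemma, attained at a = 1,
    b = 2. *)
Lemma wgt_strip11 a b : (0 < a)%N -> (0 < b)%N ->
  wgt a.+1 b.+1 <= 1 / 3 * wgt a b.
Proof.
move=> a0 b0; rewrite wgtSr wgtSl mulrA mulf_div -!natrM.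
by apply: (@ler_ratio_mul _ _ 1 3) (wgt_ge0 _ _) _ _ _; nia.
Qed.

Lemma wgt_strip11_large a b : (0 < a)%N -> (0 < b)%N -> (2 < a + b)%N ->
  wgt a.+1 b.+1 <= 3 / 10 * wgt a b.
Proof.
move=> a0 b0 ab; rewrite wgtSr wgtSl mulrA mulf_div -!natrM.
by apply: (@ler_ratio_mul _ _ 3 10) (wgt_ge0 _ _) _ _ _; try nia;
  move: a b a0 b0 ab => [|[|a]] [|[|b]] //; nia.
Qed.

(** Equality holds at a = b = 1, so the constant is optimal. *)
Lemma wgt_strip12 a b : (0 < a)%N -> wgt a.+1 b.+2 <= 1 / 5 * wgt a b.
Proof.
move=> a0; rewrite wgtSr wgtSr mulrA mulf_div wgtSl mulrA mulf_div -!natrM.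
by apply: (@ler_ratio_mul _ _ 1 5) (wgt_ge0 _ _) _ _ _; try nia;
  move: a b a0 => [|a] [|[|b]] //; nia.
Qed.

Lemma wgt_strip13 a b : (0 < a)%N -> wgt a.+1 b.+3 <= 1 / 6 * wgt a b.
Proof.
move=> a0; rewrite wgtSr wgtSr mulrA mulf_div wgtSr mulrA mulf_div.
rewrite wgtSl mulrA mulf_div -!natrM.
by apply: (@ler_ratio_mul _ _ 1 6) (wgt_ge0 _ _) _ _ _; try nia;
  move: a b a0 => [|a] [|[|b]] //; nia.
Qed.

Lemma wgt_strip22 a b : wgt a.+2 b.+2 <= 1 / 6 * wgt a b.
Proof.
rewrite wgtSr wgtSr mulrA mulf_div wgtSl mulrA mulf_div wgtSl mulrA mulf_div -!natrM.
by apply: (@ler_ratio_mul _ _ 1 6) (wgt_ge0 _ _) _ _ _; nia.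
Qed.

(** * Averaging and the Bollobas bound *)

Definition weight T X (I : {set T}) (A B : T -> {set X}) : rat :=
  \sum_(i in I) wgt #|A i| #|B i|.

Definition cross T X (I : {set T}) (A B : T -> {set X}) : Prop :=
  (forall i x, i \in I -> x \in A i -> x \notin B i) /\
  (forall i j, i \in I -> j \in I -> i != j -> exists2 x, x \in A i & x \in B j).

Definition cross1 T X (I : {set T}) (A B : T -> {set X}) : Prop :=
  cross I A B /\
  (forall i j x y, i \in I -> j \in I -> i != j ->
     x \in A i -> x \in B j -> y \in A i -> y \in B j -> x = y).

Lemma weightC T X (I : {set T}) (A B : T -> {set X}) : weight I A B = weight I B A.
Proof. by apply: eq_bigr => i _; rewrite wgtC. Qed.

Lemma crossC T X (I : {set T}) (A B : T -> {set X}) : cross I A B -> cross I B A.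
Proof.
case=> dis ex; split=> [i x iI xB|i j iI jI ij].
  by apply/negP => /(dis _ _ iI); rewrite xB.
by have [|x] := ex j i jI iI; [rewrite eq_sym|exists x].
Qed.

Lemma cross1C T X (I : {set T}) (A B : T -> {set X}) :
  cross1 I A B -> cross1 I B A.
Proof.
case=> /crossC cr uni; split=> // i j x y iI jI ij *.
by apply: (uni j i) => //; rewrite eq_sym.
Qed.

Lemma weight_sub T X (I J : {set T}) (A B : T -> {set X}) :
  J \subset I -> weight J A B <= weight I A B.
Proof.
move=> JI; rewrite /weight [leRHS](big_setID J) /= (setIidPr JI) lerDl.
by rewrite sumr_ge0 // => i _; apply: wgt_ge0.
Qed.

Lemma weightU T X (I J : {set T}) (A B : T -> {set X}) :
  weight (I :|: J) A B <= weight I A B + weight J A B.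
Proof.
rewrite /weight (big_setID I) /= setUK lerD2l.
have -> : (I :|: J) :\: I = J :\: I by rewrite setDUl setDv set0U.
by apply: weight_sub; apply: subsetDl.
Qed.

Lemma weight1 T X (i : T) (A B : T -> {set X}) : weight [set i] A B = wgt #|A i| #|B i|.
Proof. by rewrite /weight big_set1. Qed.

Lemma weight0 T X (A B : T -> {set X}) : weight set0 A B = 0.
Proof. by rewrite /weight big_set0. Qed.

(** Each [x] in [B] contributes [wgt #|A| #|B|.-1], and these terms add up to (|A| + |B|) times
    [wgt #|A| #|B|]. Each [x] outside both sets leaves the pair unchanged and contributes one more
    copy. *)
Lemma wgt_average X (A B : {set X}) : B != set0 -> [disjoint A & B] ->
  \sum_(x | x \notin A) wgt #|A| #|B :\ x| = #|X|%:R * wgt #|A| #|B|.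
Proof.
move=> B0 AB; have /card_gt0P [z zB] : (0 < #|B|)%N by rewrite card_gt0.
rewrite (bigID (mem B)) /=.
have hB : \sum_(x | (x \notin A) && (x \in B)) wgt #|A| #|B :\ x| =
   #|B|%:R * wgt #|A| #|B|.-1.
  rewrite (eq_bigl (mem B)) => [|x /=]; last first.
    by case xB: (x \in B); rewrite ?andbF // (disjointFl AB xB).
  rewrite (eq_bigr (fun=> wgt #|A| #|B|.-1)) ?sumr_const ?mulr_natl // => x xB.
  by rewrite [#|B|](cardsD1 x) (xB : x \in B).
have hC : \sum_(x | (x \notin A) && (x \notin B)) wgt #|A| #|B :\ x| =
   #|~: (A :|: B)|%:R * wgt #|A| #|B|.
  rewrite (eq_bigl (mem (~: (A :|: B)))) => [|x /=]; last by rewrite !inE negb_or.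
  rewrite (eq_bigr (fun=> wgt #|A| #|B|)) ?sumr_const ?mulr_natl // => x /=.
  rewrite !inE negb_or => /andP [_ xB]; suff -> : B :\ x = B by [].
  by apply/setDidPl; rewrite disjoint_sym disjoints1.
rewrite hB hC -(cardsC (A :|: B)) cardsU disjoint_setI0 // cards0 subn0.
rewrite [#|B|](cardsD1 z) zB add1n /= wgtSr natrD mulrDl; congr (_ + _).
by rewrite addnS mulrA [_%:R * (_ / _)]mulrC divfK // pnatr_eq0.
Qed.

(* Passing from (I, A, B) to (restrict x I A, A, delete x B) is conditioning a
   random ordering of the ground set on its last element being x, where the
   weight of a pair is the probability that A i entirely precedes B i. *)
Definition restrict T X (x : X) (I : {set T}) (A : T -> {set X}) : {set T} :=
  [set i in I | x \notin A i].

Definition delete T X (x : X) (B : T -> {set X}) (i : T) : {set X} := B i :\ x.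

Lemma weight_average T X (I : {set T}) (A B : T -> {set X}) :
  (forall i x, i \in I -> x \in A i -> x \notin B i) ->
  (forall i, i \in I -> (0 < #|B i|)%N) ->
  \sum_x weight (restrict x I A) A (delete x B) = #|X|%:R * weight I A B.
Proof.
move=> dis B0; rewrite /weight mulr_sumr.
under eq_bigr => x _ do rewrite /restrict big_mkcond /=.
rewrite exchange_big /= [RHS]big_mkcond; apply: eq_bigr => i _.
case: ifP => iI; last by apply: big1 => x _; rewrite inE iI.
rewrite -wgt_average -?card_gt0 ?B0 //; last first.
  by rewrite disjoint_subset; apply/subsetP => x /dis; apply.
by rewrite [RHS]big_mkcond; apply: eq_bigr => x _; rewrite inE iI.
Qed.

(** An element outside the support changes nothing. If every element of the support strictly lowered
    the weight, the average would be strictly below the weight, against [weight_average]. That [x]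
    lies in the support makes the total size drop in the inductions. *)
Lemma averaging T X (I : {set T}) (A B : T -> {set X}) :
  (forall i x, i \in I -> x \in A i -> x \notin B i) ->
  (forall i, i \in I -> (0 < #|B i|)%N) -> I != set0 ->
  exists2 x, (exists2 i, i \in I & x \in A i :|: B i)
    & weight I A B <= weight (restrict x I A) A (delete x B).
Proof.
move=> dis B0 /set0Pn [i0 i0I].
pose supp := \bigcup_(i in I) (A i :|: B i).
case: (boolP [exists x in supp, weight I A B <= weight (restrict x I A) A (delete x B)]).
  by case/exists_inP => x /bigcupP [i iI xi] h; exists x => //; exists i.
rewrite negb_exists_in => /forall_inP hlt.
have /card_gt0P [x0 x0B] := B0 _ i0I.
have x0s : x0 \in supp by apply/bigcupP; exists i0; rewrite // inE x0B orbT.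
have le x : weight (restrict x I A) A (delete x B) <= weight I A B.
  case xs : (x \in supp); first by rewrite ltW // ltNge hlt.
  have nx i : i \in I -> x \notin A i :|: B i.
    by move=> iI; apply/negP => xi; case/negP: (negbT xs); apply/bigcupP; exists i.
  rewrite le_eqVlt; apply/orP; left; apply/eqP.
  rewrite /weight; apply: eq_big => i; rewrite inE.
    by case iI: (i \in I) => //=; have:= nx i iI; rewrite inE negb_or => /andP [].
  case/andP => iI _; have := nx i iI; rewrite inE negb_or => /andP [_ xB].
  by rewrite /delete (setDidPl _) // disjoint_sym disjoints1.
have : #|X|%:R * weight I A B < #|X|%:R * weight I A B.
  rewrite -{1}weight_average // mulr_natl -sumr_const.
  rewrite (bigD1 x0) //= [ltRHS](bigD1 x0) //= ltr_leD ?ler_sum //.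
  by rewrite ltNge hlt.
by rewrite ltxx.
Qed.

Definition total_size T X (I : {set T}) (A B : T -> {set X}) : nat :=
  (\sum_(i in I) (#|A i| + #|B i|))%N.

Lemma total_sizeC T X (I : {set T}) (A B : T -> {set X}) :
  total_size I A B = total_size I B A.
Proof. by apply: eq_bigr => i _; rewrite addnC. Qed.

Lemma total_size_delete T X (I : {set T}) (A B : T -> {set X}) i x :
  i \in I -> x \in A i :|: B i ->
  (total_size (restrict x I A) A (delete x B) < total_size I A B)%N.
Proof.
move=> iI xi; rewrite /total_size [in X in (_ < X)%N](bigID (fun j => x \notin A j)) /=.
have le j : (#|A j| + #|B j :\ x| <= #|A j| + #|B j|)%N.
  by rewrite leq_add2l subset_leq_card // subsetDl.
rewrite (eq_bigl (fun j => (j \in I) && (x \notin A j))); last by move=> j; rewrite inE.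
case xA: (x \in A i).
  rewrite -addn1 leq_add ?leq_sum //.
  rewrite (bigD1 i) ?iI ?xA //= -addnA addn_gt0 card_gt0.
  by apply/orP; left; apply/set0Pn; exists x.
have xB : x \in B i by move: xi; rewrite inE xA.
apply: leq_trans (leq_addr _ _).
rewrite (bigD1 i) ?iI ?xA //= [X in (_ < X)%N](bigD1 i) ?iI ?xA //=.
rewrite -addSn leq_add ?leq_sum // -addnS leq_add2l.
by rewrite /delete [X in (_ < X)%N](cardsD1 x) xB.
Qed.

(** A common element of [A i] and [B j] differs from [x], because the surviving [A i] avoid [x]; so
    it is still in [B j] after the deletion. *)
Lemma cross_delete T X (I : {set T}) (A B : T -> {set X}) x :
  cross I A B -> cross (restrict x I A) A (delete x B).
Proof.
case=> dis ex; split => [i y|i j].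
  by rewrite !inE => /andP [iI _] /(dis _ _ iI) /negbTE ->; rewrite andbF.
rewrite !inE => /andP [iI xA] /andP [jI _] ij.
have [y yA yB] := ex i j iI jI ij; exists y; rewrite // !inE yB andbT.
by apply: contra xA => /eqP <-.
Qed.

Lemma cross1_delete T X (I : {set T}) (A B : T -> {set X}) x :
  cross1 I A B -> cross1 (restrict x I A) A (delete x B).
Proof.
case=> cr uni; split; first exact: cross_delete.
move=> i j y z; rewrite !inE => /andP [iI _] /andP [jI _] ij yA /andP [_ yB] zA /andP [_ zB].
exact: (uni i j).
Qed.

(** Averaging reduces the total size until some [B i] is empty. *)
Lemma bollobas T X (I : {set T}) (A B : T -> {set X}) :
  cross I A B -> weight I A B <= 1.
Proof.
have [n] := ubnP (total_size I A B).
elim: n I A B => // n IH I A B; rewrite ltnS => sz cr; have [dis ex] := cr.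
have [->|I0] := eqVneq I set0; first by rewrite weight0 ler01.
case: (boolP [exists i in I, #|B i| == 0%N]).
  (* No other [A j] can meet an empty [B i], so [i] is the only index and the weight is 1. *)
  case/exists_inP => i iI /eqP Bi0.
  have -> : I = [set i].
    apply/eqP; rewrite eqEsubset sub1set iI andbT; apply/subsetP => j jI.
    rewrite inE; apply/negPn/negP => ji; have [x _] := ex _ _ jI iI ji.
    by move/card0_eq: Bi0 => ->.
  by rewrite weight1 Bi0 wgt0r.
rewrite negb_exists_in => /forall_inP B0.
have [x [i iI xi] h] := averaging dis (fun i iI => (ltac:(by rewrite lt0n B0))) I0.
apply: le_trans h _; apply: IH; last exact: cross_delete.
exact: leq_trans (total_size_delete iI xi) sz.
Qed.

(** * Comparison with a smaller cross intersecting family *)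

Lemma weight_le_cross T X (I : {set T}) (A B A' B' : T -> {set X}) c :
  0 <= c -> cross I A' B' ->
  (forall i, i \in I -> wgt #|A i| #|B i| <= c * wgt #|A' i| #|B' i|) ->
  weight I A B <= c.
Proof.
move=> c0 cr h; apply: (@le_trans _ _ (c * weight I A' B')).
  by rewrite /weight mulr_sumr ler_sum.
by rewrite ler_piMr // bollobas.
Qed.

(* Elements common to all A i never lie in any B j, so deleting them keeps the
   family cross intersecting; c bounds the change of weight of a single pair. *)
Lemma weight_strip T X (I : {set T}) (A B : T -> {set X}) (U V : {set X}) c :
  0 <= c -> cross I A B -> (forall i, i \in I -> U \subset A i /\ V \subset B i) ->
  (forall i, i \in I ->
     wgt #|A i| #|B i| <= c * wgt (#|A i| - #|U|) (#|B i| - #|V|)) ->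
  weight I A B <= c.
Proof.
move=> c0 [dis ex] UV h.
apply: (weight_le_cross c0 (A' := fun i => A i :\: U) (B' := fun i => B i :\: V)).
  split=> [i x iI|i j iI jI ij].
    by rewrite !inE => /andP [_ /(dis _ _ iI) /negbTE ->]; rewrite andbF.
  have [x xA xB] := ex i j iI jI ij; exists x; rewrite !inE ?xA ?xB andbT.
    have [/subsetP UA _] := UV j jI; apply: contraL xB => /UA; exact: dis.
  have [_ /subsetP VB] := UV i iI; apply: contraL xA => /VB xBi.
  by apply/negP => /(dis _ _ iI); rewrite xBi.
by move=> i iI; have [UA VB] := UV i iI; rewrite !cardsDS // h.
Qed.

(** * Systems with one singleton *)

Lemma wgt_values : [/\ wgt 1 1 = 1 / 2, wgt 2 1 = 1 / 3, wgt 3 1 = 1 / 4,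
  wgt 2 2 = 1 / 6 & wgt 3 2 = 1 / 10].
Proof. by rewrite !wgtE. Qed.

Lemma weight_cover T X (I J K : {set T}) (A B : T -> {set X}) :
  I \subset J :|: K -> weight I A B <= weight J A B + weight K A B.
Proof. by move=> IJK; apply: le_trans (weightU J K A B); apply: weight_sub. Qed.

Lemma cross_sub T X (I J : {set T}) (A B : T -> {set X}) :
  J \subset I -> cross I A B -> cross J A B.
Proof.
move=> /subsetP JI [dis ex]; split=> [i x /JI|i j /JI iI /JI]; first exact: dis.
exact: ex.
Qed.

Lemma weight_strip11 T X (I : {set T}) (A B : T -> {set X}) u v :
  cross I A B ->
  (forall i, i \in I ->
     [/\ u \in A i, v \in B i, (2 <= #|A i|)%N & (2 <= #|B i|)%N]) ->
  weight I A B <= 1 / 3.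
Proof.
move=> cr h.
apply: (weight_strip (U := [set u]) (V := [set v]) (divr_ge0 ler01 (ler0n _ 3)) cr).
  by move=> i /h [uA vB _ _]; rewrite !sub1set.
move=> i /h [_ _ /subnK <- /subnK <-]; rewrite !cards1 !addn2 !subn1.
exact: wgt_strip11.
Qed.

Lemma weight_strip11_large T X (I : {set T}) (A B : T -> {set X}) u v :
  cross I A B ->
  (forall i, i \in I ->
     [/\ u \in A i, v \in B i, (2 <= #|A i|)%N & (2 <= #|B i|)%N]) ->
  (forall i, i \in I -> (4 < #|A i| + #|B i|)%N) ->
  weight I A B <= 3 / 10.
Proof.
move=> cr h n22.
apply: (weight_strip (U := [set u]) (V := [set v]) (divr_ge0 (ler0n _ 3) (ler0n _ 10)) cr).
  by move=> i /h [uA vB _ _]; rewrite !sub1set.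
move=> i iI; case: (h i iI) (n22 i iI) => _ _ /subnK <- /subnK <-.
rewrite !cards1 !addn2 !subn1 => ab; apply: wgt_strip11_large; lia.
Qed.

Lemma weight_strip12 T X (I : {set T}) (A B : T -> {set X}) u v w :
  cross I A B -> v != w ->
  (forall i, i \in I ->
     [/\ u \in A i, v \in B i, w \in B i & (2 <= #|A i|)%N]) ->
  weight I A B <= 1 / 5.
Proof.
move=> cr vw h; have UV i : i \in I -> [set u] \subset A i /\ [set v; w] \subset B i.
  by case/h => uA vB wB _; rewrite !subUset !sub1set uA vB wB.
apply: (weight_strip (divr_ge0 ler01 (ler0n _ 5)) cr UV) => i iI.
have [_ /subset_leq_card] := UV i iI.
rewrite !cards1 cards2 vw /= => /subnK <-; case: (h i iI) => _ _ _ /subnK <-.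
rewrite !addn2 subn1 !subn2; exact: wgt_strip12.
Qed.

Lemma weight_strip21 T X (I : {set T}) (A B : T -> {set X}) u v w :
  cross I A B -> u != v ->
  (forall i, i \in I ->
     [/\ u \in A i, v \in A i, w \in B i & (2 <= #|B i|)%N]) ->
  weight I A B <= 1 / 5.
Proof.
move=> /crossC cr uv h; rewrite weightC.
by apply: (weight_strip12 cr uv (u := w)) => i /h [].
Qed.

Lemma weight_strip22 T X (I : {set T}) (A B : T -> {set X}) u1 u2 v1 v2 :
  cross I A B -> u1 != u2 -> v1 != v2 ->
  (forall i, i \in I ->
     [/\ u1 \in A i, u2 \in A i, v1 \in B i & v2 \in B i]) ->
  weight I A B <= 1 / 6.
Proof.
move=> cr u12 v12 h.
have UV i : i \in I -> [set u1; u2] \subset A i /\ [set v1; v2] \subset B i.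
  by case/h => u1A u2A v1B v2B; rewrite !subUset !sub1set u1A u2A v1B v2B.
apply: (weight_strip (divr_ge0 ler01 (ler0n _ 6)) cr UV) => i iI.
have [/subset_leq_card + /subset_leq_card] := UV i iI.
rewrite !cards2 u12 v12 /= => /subnK <- /subnK <-.
rewrite !addn2 !subn2; exact: wgt_strip22.
Qed.

Lemma weight_strip13 T X (I : {set T}) (A B : T -> {set X}) u v1 v2 v3 :
  cross I A B -> v1 != v2 -> v1 != v3 -> v2 != v3 ->
  (forall i, i \in I ->
     [/\ u \in A i, v1 \in B i, v2 \in B i, v3 \in B i & (2 <= #|A i|)%N]) ->
  weight I A B <= 1 / 6.
Proof.
move=> cr v12 v13 v23 h.
have UV i : i \in I -> [set u] \subset A i /\ [set v1; v2; v3] \subset B i.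
  by case/h => uA v1B v2B v3B _; rewrite !subUset !sub1set uA v1B v2B v3B.
have c3 : #|[set v1; v2; v3]| = 3.
  by rewrite setUC cardsU1 cards2 v12 !inE ![v3 == _]eq_sym negb_or v13 v23.
apply: (weight_strip (divr_ge0 ler01 (ler0n _ 6)) cr UV) => i iI.
have [_ /subset_leq_card] := UV i iI.
rewrite cards1 c3 => /subnK <-; case: (h i iI) => _ _ _ _ /subnK <-.
rewrite addn2 subn1 addn3 !subSS subn0; exact: wgt_strip13.
Qed.

Lemma weight_strip31 T X (I : {set T}) (A B : T -> {set X}) u1 u2 u3 v :
  cross I A B -> u1 != u2 -> u1 != u3 -> u2 != u3 ->
  (forall i, i \in I ->
     [/\ u1 \in A i, u2 \in A i, u3 \in A i, v \in B i & (2 <= #|B i|)%N]) ->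
  weight I A B <= 1 / 6.
Proof.
move=> /crossC cr u12 u13 u23 h; rewrite weightC.
by apply: (weight_strip13 cr u12 u13 u23 (u := v)) => i /h [].
Qed.

(** * Two-element sets in a 1-cross intersecting system *)

Lemma card2_mem X (S : {set X}) x :
  #|S| = 2 -> x \in S -> exists2 y, y != x & S = [set x; y].
Proof.
move=> /eqP /cards2P [a [b [ab ->]]]; rewrite !inE => /orP [] /eqP ->.
  by exists b; rewrite // eq_sym.
by exists a; rewrite // setUC.
Qed.

(** With its companions below: a two-element set meets every opposite set of another index in
    exactly one of its points. This is the source of the forced memberships that feed the strip
    bounds. *)
Lemma hit_pairl T X (I : {set T}) (A B : T -> {set X}) i j u v :
  cross1 I A B -> i \in I -> j \in I -> i != j ->
  A i = [set u; v] -> u \notin B j -> v \in B j.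
Proof.
case=> -[_ ex] _ iI jI ij Ai uB; have [x] := ex i j iI jI ij.
by rewrite Ai !inE => /orP [] /eqP -> //; rewrite (negPf uB).
Qed.

Lemma hit_pairl_uniq T X (I : {set T}) (A B : T -> {set X}) i j u v :
  cross1 I A B -> i \in I -> j \in I -> i != j ->
  A i = [set u; v] -> u != v -> u \in B j -> v \notin B j.
Proof.
case=> _ uni iI jI ij Ai uv uB; apply/negP => vB; case/eqP: uv.
by apply: (uni i j) => //; rewrite Ai !inE eqxx ?orbT.
Qed.

Lemma hit_pairr T X (I : {set T}) (A B : T -> {set X}) i j u v :
  cross1 I A B -> i \in I -> j \in I -> i != j ->
  B i = [set u; v] -> u \notin A j -> v \in A j.
Proof. by move/cross1C; apply: hit_pairl. Qed.

Lemma hit_pairr_uniq T X (I : {set T}) (A B : T -> {set X}) i j u v :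
  cross1 I A B -> i \in I -> j \in I -> i != j ->
  B i = [set u; v] -> u != v -> u \in A j -> v \notin A j.
Proof. by move/cross1C; apply: hit_pairl_uniq. Qed.

Lemma cross1_notinB T X (I : {set T}) (A B : T -> {set X}) i x :
  cross1 I A B -> i \in I -> x \in A i -> x \notin B i.
Proof. by case=> -[dis _] _; apply: dis. Qed.

Lemma cross1_notinA T X (I : {set T}) (A B : T -> {set X}) i x :
  cross1 I A B -> i \in I -> x \in B i -> x \notin A i.
Proof. by move=> /cross1C; apply: cross1_notinB. Qed.

(* One pair with #|B i| = 1 is tolerated so that deleting x stays in the class
   unless x lies in two 2-element sets B i. *)
Definition bounded_below n T X : Prop :=
  forall (I : {set T}) (A B : T -> {set X}),
    (total_size I A B < n)%N -> cross1 I A B ->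
    (forall i, i \in I -> (2 <= #|A i|)%N) ->
    (forall i, i \in I -> (1 <= #|B i|)%N) ->
    (forall i j, i \in I -> j \in I -> #|B i| = 1 -> #|B j| = 1 -> i = j) ->
    weight I A B <= 5 / 6.

(** With [B i0] = {y}, the point [y] lies in every other [A j]. Either another [A k] has two
    elements and the bound is direct, or the other [A j] are large enough to lose an element. *)
Lemma weight_le_singleton T X (I : {set T}) (A B : T -> {set X}) i0 :
  bounded_below (total_size I A B) T X -> cross1 I A B ->
  (forall i, i \in I -> (2 <= #|A i|)%N) ->
  i0 \in I -> #|B i0| = 1 ->
  (forall i, i \in I -> i != i0 -> (2 <= #|B i|)%N) ->
  weight I A B <= 5 / 6.
Proof.
move=> IH cr A2 i0I /eqP /cards1P [y Bi0] B2.
have yA j : j \in I -> j != i0 -> y \in A j.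
  move=> jI ji; case: cr => -[_ ex] _; have [x xA] := ex j i0 jI i0I ji.
  by rewrite Bi0 inE => /eqP <-.
have yA0 : y \notin A i0 by apply: (cross1_notinA cr) => //; rewrite Bi0 inE.
have yB j : j \in I -> j != i0 -> y \notin B j.
  by move=> jI ji; apply: (cross1_notinB cr) => //; apply: yA.
(* If [A k] = {y, v}, every remaining pair has [y] in its [A] and [v] in its [B]; the total is at
   most 1/3 + 1/6 + 1/3 = 5/6. *)
case: (boolP [exists k in I, (k != i0) && (#|A k| == 2)]).
  case/exists_inP => k kI /andP [ki /eqP Ak2].
  have [v vy Ak] := card2_mem Ak2 (yA k kI ki).
  have cov : I \subset [set i0] :|: ([set k] :|: I :\: [set i0; k]).
    by apply/subsetP => j jI; rewrite !inE jI andbT; case: (j == i0); case: (j == k).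
  have h3 : weight (I :\: [set i0; k]) A B <= 1 / 3.
    apply: (@weight_strip11 _ _ _ _ _ y v).
      by apply: cross_sub (subsetDl _ _) _; case: cr.
    move=> j; rewrite !inE negb_or => /andP [/andP [ji jk] jI].
    split; rewrite ?yA ?A2 ?B2 //.
    by apply: (hit_pairl cr kI jI _ Ak); rewrite ?yB // eq_sym.
  have h1 : wgt #|A i0| #|B i0| <= 1 / 3 by have [_ <- _ _ _] := wgt_values; rewrite wgt_le ?A2 // Bi0 cards1.
  have h2 : wgt #|A k| #|B k| <= 1 / 6 by have [_ _ _ <- _] := wgt_values; rewrite wgt_le ?A2 ?B2.
  have := weight_cover A B cov.
  have := weightU [set k] (I :\: [set i0; k]) A B.
  rewrite !weight1; lra.
rewrite negb_exists_in => /forall_inP A3'.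
have A3 k : k \in I -> k != i0 -> (3 <= #|A k|)%N.
  by move=> kI ki; rewrite ltn_neqAle A2 // andbT eq_sym; have := A3' k kI; rewrite ki.
have A1 i : i \in I -> (0 < #|A i|)%N by move=> /A2; apply: ltn_trans.
have I0 : I != set0 by apply/set0Pn; exists i0.
(* Averaging with the two sides exchanged: [x] is removed from the [A j], which have at least three
   elements for [j != i0]. *)
have [x [i iI xi]] := averaging (fun i x iI => cross1_notinA cr iI) A1 I0.
rewrite !(weightC _ B) => h; apply: le_trans h _.
have crx := cross1C (cross1_delete x (cross1C cr)).
have sz : (total_size (restrict x I B) (delete x A) B < total_size I A B)%N.
  by rewrite !(total_sizeC _ _ B) (total_size_delete iI xi).
have A2x j : j \in I -> j != i0 -> (2 <= #|delete x A j|)%N.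
  by move=> jI ji; have := A3 j jI ji; rewrite (cardsD1 x); case: (x \in A j) => // /ltnW.
have B1 j : j \in I -> (1 <= #|B j|)%N.
  by move=> jI; have [->|/(B2 j jI)/ltnW //] := eqVneq j i0; rewrite Bi0 cards1.
have B1i j : j \in I -> #|B j| = 1 -> j = i0.
  by move=> jI Bj; apply/eqP/negPn/negP => /(B2 j jI); rewrite Bj.
(* For [x = y] the index [i0] itself is dropped. *)
have [Ex|nxy] := eqVneq x y.
  have ni0 j : j \in restrict x I B -> j \in I /\ j != i0.
    rewrite inE Ex => /andP [jI yBj]; split=> //; apply: contra yBj => /eqP ->.
    by rewrite Bi0 inE.
  apply: (IH _ _ _ sz crx) => [j /ni0 [jI ji]|j /ni0 [jI _]|j k /ni0 [jI ji] _ Bj].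
  - exact: A2x.
  - exact: B1.
  - by rewrite (B1i j jI Bj) eqxx in ji.
(* If [A i0] = {x, v}, the pair [i0] shrinks to weight 1/2. The other survivors avoid [x] in [B j],
   so [v] is in [B j], while [y] stays in [A j]: the total is at most 1/2 + 1/3. In all remaining
   cases induction applies. *)
have [/andP [/eqP Ai02 xA0]|nA2] := boolP ((#|A i0| == 2) && (x \in A i0)).
  have [v vx Ai0] := card2_mem Ai02 xA0.
  have cov : restrict x I B \subset [set i0] :|: restrict x (I :\ i0) B.
    by apply/subsetP => j; rewrite !inE; case: (j == i0).
  apply: le_trans (weight_cover _ _ cov) _; rewrite weight1.
  have -> : #|delete x A i0| = 1.
    by move: Ai02; rewrite (cardsD1 x) xA0 => -[].
  rewrite Bi0 cards1.
  have : weight (restrict x (I :\ i0) B) (delete x A) B <= 1 / 3.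
    apply: (@weight_strip11 _ _ _ _ _ y v).
      apply: cross_sub crx.1; apply/subsetP => j.
      by rewrite !inE => /andP [/andP [_ ->] ->].
    move=> j; rewrite !inE => /andP [/andP [ji jI] xB].
    split; rewrite ?A2x ?B2 //; first by rewrite eq_sym nxy yA.
    by apply: (hit_pairl cr i0I jI _ Ai0); rewrite // eq_sym.
  have [-> _ _ _ _] := wgt_values; lra.
apply: (IH _ _ _ sz crx) => [j|j|j k]; rewrite !inE => /andP [jI _].
- have [->|/(A2x j jI) //] := eqVneq j i0.
  move: nA2 (A2 _ i0I); rewrite /delete (cardsD1 x (A i0)); case: (x \in A i0) => //.
  by rewrite andbT add1n eqSS; case: #|_| => [|[]].
- exact: B1.
- by move=> /andP [kI _] Bj Bk; rewrite (B1i j) // (B1i k).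
Qed.

(** * Systems with all sets of size at least two *)

Lemma weight_pair_le T X (A B : T -> {set X}) i a b :
  (a <= #|A i|)%N -> (b <= #|B i|)%N -> weight [set i] A B <= wgt a b.
Proof. by move=> *; rewrite weight1 wgt_le. Qed.

(** Every other [A j] contains either [x] or both [y1] and [y2]; every other [B j] contains either
    [e] or both. This gives the classes [J1], [J2], [J3]; the fourth would put [y1] into both [A j]
    and [B j]. *)
Lemma weight_le_twin T X (I : {set T}) (A B : T -> {set X}) i1 i2 x y1 y2 e :
  cross1 I A B -> (forall i, i \in I -> (2 <= #|A i|)%N /\ (2 <= #|B i|)%N) ->
  i1 \in I -> i2 \in I -> i1 != i2 -> x != y1 -> x != y2 ->
  A i1 = [set y2; e] -> B i1 = [set x; y1] ->
  A i2 = [set y1; e] -> B i2 = [set x; y2] ->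
  weight I A B <= 5 / 6.
Proof.
move=> cr sz i1I i2I i12 xy1 xy2 A1 B1 A2 B2.
have y12 : y1 != y2.
  have : y2 \notin B i1 by rewrite (cross1_notinB cr) // A1 !inE eqxx.
  by rewrite B1 !inE negb_or ![y2 == _]eq_sym => /andP [].
have ey2 : y2 != e.
  have : e \notin B i2 by rewrite (cross1_notinB cr) // A2 !inE eqxx orbT.
  by rewrite B2 !inE negb_or ![e == _]eq_sym => /andP [].
have ey1 : y1 != e.
  have : e \notin B i1 by rewrite (cross1_notinB cr) // A1 !inE eqxx orbT.
  by rewrite B1 !inE negb_or ![e == _]eq_sym => /andP [].
pose J := I :\: [set i1; i2].
have JI j : j \in J -> [/\ j \in I, i1 != j & i2 != j].
  by rewrite !inE negb_or ![j == _]eq_sym => /andP [/andP []].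
have JD j : j \in I -> [|| j == i1, j == i2 | j \in J].
  by move=> jI; rewrite !inE jI andbT orbA orbN.
have crJ : cross J A B by apply: cross_sub (subsetDl _ _) cr.1.
clearbody J.
pose J1 := [set j in J | (x \in A j) && (e \in B j)].
pose J2 := [set j in J | (x \in A j) && (e \notin B j)].
pose J3 := [set j in J | (x \notin A j) && (e \in B j)].
have cr1 : cross J1 A B by apply: cross_sub crJ; apply/subsetP => j; rewrite inE => /andP [].
have cr2 : cross J2 A B by apply: cross_sub crJ; apply/subsetP => j; rewrite inE => /andP [].
have cr3 : cross J3 A B by apply: cross_sub crJ; apply/subsetP => j; rewrite inE => /andP [].
have yA j : j \in J -> x \notin A j -> (y1 \in A j) && (y2 \in A j).
  by case/JI => jI j1 j2 xA; rewrite (hit_pairr cr i1I jI j1 B1 xA) (hit_pairr cr i2I jI j2 B2 xA).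
have nyA j : j \in J -> x \in A j -> (y1 \notin A j) && (y2 \notin A j).
  case/JI => jI j1 j2 xA.
  by rewrite (hit_pairr_uniq cr i1I jI j1 B1) ?(hit_pairr_uniq cr i2I jI j2 B2).
have yB j : j \in J -> e \notin B j -> (y1 \in B j) && (y2 \in B j).
  case/JI => jI j1 j2 eB; rewrite setUC in A1; rewrite setUC in A2.
  by rewrite (hit_pairl cr i1I jI j1 A1 eB) (hit_pairl cr i2I jI j2 A2 eB).
have nyB j : j \in J -> e \in B j -> (y1 \notin B j) && (y2 \notin B j).
  case/JI => jI j1 j2 eB; rewrite setUC in A1; rewrite setUC in A2.
  by rewrite (hit_pairl_uniq cr i1I jI j1 A1) 1?eq_sym // (hit_pairl_uniq cr i2I jI j2 A2) 1?eq_sym.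
have cov : I \subset [set i1] :|: ([set i2] :|: (J1 :|: (J2 :|: J3))).
  apply/subsetP => j /[dup] jI /JD; rewrite !inE.
  case: (j == i1) (j == i2) => [] [] //= jJ; rewrite jJ /=.
  case xA: (x \in A j); case eB: (e \in B j) => //=; exfalso.
  have /andP [y1A _] := yA j jJ (negbT xA); have /andP [y1B _] := yB j jJ (negbT eB).
  have [jI' _ _] := JI j jJ.
  by have := cross1_notinB cr jI' y1A; rewrite y1B.
(* A pair of J2 and a pair of J3 would share both y1 and y2. *)
have J23 : (J2 == set0) || (J3 == set0).
  case: (set_0Vmem J2) => [->|[j2]]; first by rewrite eqxx.
  case: (set_0Vmem J3) => [->|[j3]]; first by rewrite eqxx orbT.
  rewrite !inE => /and3P [j3J xA3 eB3] /and3P [j2J xA2 eB2]; exfalso.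
  have /andP [a1 a2] := yA j3 j3J xA3; have /andP [b1 b2] := yB j2 j2J eB2.
  have [[j3I _ _] [j2I _ _]] := (JI j3 j3J, JI j2 j2J).
  case/eqP: y12; case: cr => _ uni; apply: (uni j3 j2) => //.
  by apply: contraNneq xA3 => ->.
have w23 c : 0 <= c -> weight J2 A B <= c -> weight J3 A B <= c ->
    weight (J2 :|: J3) A B <= c.
  by move=> c0 h2 h3; case/orP: J23 => /eqP ->; rewrite ?set0U ?setU0.
have w1 : weight [set i1] A B <= 1 / 6.
  by have [_ _ _ <- _] := wgt_values; case: (sz i1 i1I); apply: weight_pair_le.
have w2 : weight [set i2] A B <= 1 / 6.
  by have [_ _ _ <- _] := wgt_values; case: (sz i2 i2I); apply: weight_pair_le.
have := weight_cover A B cov.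
have := weightU [set i2] (J1 :|: (J2 :|: J3)) A B.
have := weightU J1 (J2 :|: J3) A B.
(* The two given pairs use at most 1/6 each. *)
suff : weight J1 A B + weight (J2 :|: J3) A B <= 1 / 2 by lra.
have m1 j : j \in J1 -> [/\ x \in A j, e \in B j, (2 <= #|A j|)%N & (2 <= #|B j|)%N].
  by rewrite inE => /and3P [/JI [/sz [] ]].
(* Without a pair of two 2-element sets in [J1] the bounds 3/10 + 1/5 suffice. Such a pair costs 1/3
   but forces a third common element in [J2] or [J3], which then weigh at most 1/6. *)
have [j0P|no22] := boolP [exists j in J1, (#|A j| + #|B j| <= 4)%N]; last first.
  have h1 : weight J1 A B <= 3 / 10.
    apply: (weight_strip11_large cr1 m1) => j jJ1; rewrite ltnNge.
    by apply: contra no22 => h; apply/exists_inP; exists j.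
  suff : weight (J2 :|: J3) A B <= 1 / 5 by lra.
  apply: w23; first exact: divr_ge0 ler01 (ler0n _ 5).
    apply: (weight_strip12 cr2 y12 (u := x)) => j; rewrite inE => /and3P [jJ xA eB].
    have [jI _ _] := JI j jJ; have /andP [-> ->] := yB j jJ eB.
    by case: (sz j jI).
  apply: (weight_strip21 cr3 y12 (w := e)) => j; rewrite inE => /and3P [jJ xA eB].
  have [jI _ _] := JI j jJ; have /andP [-> ->] := yA j jJ xA.
  by case: (sz j jI).
have h1 : weight J1 A B <= 1 / 3 by apply: (weight_strip11 cr1 m1).
suff : weight (J2 :|: J3) A B <= 1 / 6 by lra.
case/exists_inP: j0P => j0 j0J1 s4.
have [xA0 eB0 a2 b2] := m1 j0 j0J1.
have j0J : j0 \in J by move: j0J1; rewrite inE => /andP [].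
have [j0I _ _] := JI _ j0J.
have [p px Ap] : exists2 p, p != x & A j0 = [set x; p] by apply: card2_mem => //; move: a2 b2 s4; clear; lia.
have [q qe Bq] : exists2 q, q != e & B j0 = [set e; q] by apply: card2_mem => //; move: a2 b2 s4; clear; lia.
have /andP [y1p y2p] : (y1 != p) && (y2 != p).
  have := nyA j0 j0J xA0; rewrite Ap !inE !negb_or.
  by case/andP => /andP [_ ->] /andP [_ ->].
have /andP [y1q y2q] : (y1 != q) && (y2 != q).
  have := nyB j0 j0J eB0; rewrite Bq !inE !negb_or.
  by case/andP => /andP [_ ->] /andP [_ ->].
apply: w23; first exact: divr_ge0 ler01 (ler0n _ 6).
  apply: (weight_strip13 cr2 y12 y1p y2p (u := x)) => j; rewrite inE => /and3P [jJ xA eB].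
  have [jI _ _] := JI j jJ; have /andP [-> ->] := yB j jJ eB.
  split=> //; last by case: (sz j jI).
  apply: (hit_pairl cr j0I jI _ Ap); last exact: (cross1_notinB cr).
  by apply: contraNneq eB => <-.
apply: (weight_strip31 cr3 y12 y1q y2q (v := e)) => j; rewrite inE => /and3P [jJ xA eB].
have [jI _ _] := JI j jJ; have /andP [-> ->] := yA j jJ xA.
split=> //; last by case: (sz j jI).
apply: (hit_pairr cr j0I jI _ Bq); last exact: (cross1_notinA cr).
by apply: contraNneq xA => <-.
Qed.

(* The only local structure at x that can make the weight exceed 5/6 after
   deleting x (apart from the one excluded by weight_le_twin). *)
Definition heavy T X (I : {set T}) (A B : T -> {set X}) : Prop :=
  exists x y1 y2 i1 i2,
    [/\ i1 \in I, i2 \in I & i1 != i2] /\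
    [/\ B i1 = [set x; y1], B i2 = [set x; y2], x != y1, x != y2 &
        (3 <= #|A i1|)%N /\ (3 <= #|A i2|)%N].

(** [R] is the family left after deleting the [x] found by averaging, and [D] collects its members
    whose [B j] becomes a singleton. Induction applies unless [D] has two members; two members of
    [D] with large [A] make the system heavy. *)
Lemma weight_le_or_heavy T X (I : {set T}) (A B : T -> {set X}) :
  bounded_below (total_size I A B) T X -> cross1 I A B ->
  (forall i, i \in I -> (2 <= #|A i|)%N /\ (2 <= #|B i|)%N) ->
  weight I A B <= 5 / 6 \/ heavy I A B.
Proof.
move=> IH cr sz.
have [->|I0] := eqVneq I set0.
  by left; rewrite weight0 (divr_ge0 (ler0n _ 5) (ler0n _ 6)).
have B0 i : i \in I -> (0 < #|B i|)%N by case/sz => _ /ltnW.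
have [x [i iI xi] h] := averaging (fun i x iI => cross1_notinB cr iI) B0 I0.
have szx := total_size_delete iI xi.
have crx := cross1_delete x cr.
pose R := restrict x I A; pose D := [set j in R | #|delete x B j| == 1%N].
have RI j : j \in R -> j \in I /\ x \notin A j by rewrite inE => /andP [].
have Bx j : j \in R -> (1 <= #|delete x B j|)%N.
  case/RI => /sz [_] + _; rewrite (cardsD1 x); case: (x \in B j) => // /ltnW //.
have DP j : j \in D -> [/\ j \in I, x \notin A j & exists2 y, x != y & B j = [set x; y]].
  rewrite inE => /andP [jR /eqP cj]; have [jI xA] := RI j jR; split=> //.
  have xB : x \in B j.
    move: (sz j jI).2; rewrite (cardsD1 x); case: (x \in B j) => //.
    by rewrite -[_ :\ _]/(delete x B j) cj.
  have [|y yx ->] := @card2_mem _ (B j) x _ xB; last by exists y; rewrite // eq_sym.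
  by rewrite (cardsD1 x) xB -[_ :\ _]/(delete x B j) cj.
have [/card_gt1P [k1 [k2 [k1D k2D k12]]]|D1] := boolP (1 < #|D|)%N; last first.
  left; apply: le_trans h _; apply: (IH _ _ _ szx crx) => [j /RI [/sz []] //|j /Bx //|].
  move=> j k jR kR cj ck; apply/eqP; apply: contraR D1 => jk; apply/card_gt1P.
  by exists j, k; rewrite !inE in jR kR *; rewrite jR kR cj ck jk.
have [/exists_inP [j1 j1D /exists_inP [j2 j2D /and3P [j12 a1 a2]]]|nh] := boolP
  [exists j1 in D, exists j2 in D, [&& j1 != j2, (3 <= #|A j1|)%N & (3 <= #|A j2|)%N]].
  right; have [j1I _ [y1 xy1 B1]] := DP _ j1D; have [j2I _ [y2 xy2 B2]] := DP _ j2D.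
  by exists x, y1, y2, j1, j2.
left.
have lt3 j : j \in D -> (3 <= #|A j|)%N = false -> #|A j| = 2.
  by case/DP => /sz [s _] _ _; move: s; clear; lia.
have two j k : j \in D -> k \in D -> j != k -> #|A j| = 2 \/ #|A k| = 2.
  move=> jD kD jk; case s3: (3 <= #|A j|)%N; last by left; apply: lt3.
  case t3: (3 <= #|A k|)%N; last by right; apply: lt3.
  case/negP: nh; apply/exists_inP; exists j => //; apply/exists_inP; exists k => //.
  by rewrite jk s3 t3.
have [i1 [i2 [i1D i2D i12 a1]]] :
    exists i1 i2, [/\ i1 \in D, i2 \in D, i1 != i2 & #|A i1| = 2].
  case: (two _ _ k1D k2D k12) => s; first by exists k1, k2.
  by exists k2, k1; rewrite eq_sym.
(* The second index is chosen with [#|A i2| = 2] if possible; otherwise [D] consists of [i1] and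
   [i2] only, so no further singleton occurs. *)
have {i2 i2D i12} [i2 [i2D i12 hi2]] : exists i2, [/\ i2 \in D, i1 != i2 &
    #|A i2| = 2 \/ (3 <= #|A i2|)%N /\ D \subset [set i1; i2]].
  case: (boolP [exists k in D, (i1 != k) && (#|A k| == 2)]) => [|nk].
    by case/exists_inP => k kD /andP [ki /eqP Ak]; exists k; split=> //; left.
  have k3 k : k \in D -> i1 != k -> (3 <= #|A k|)%N.
    move=> kD ki; apply/negPn/negP => /negbTE /(lt3 _ kD) s; case/negP: nk.
    by apply/exists_inP; exists k; rewrite ?ki ?s.
  exists i2; split=> //; right; split; first exact: k3.
  apply/subsetP => k kD; rewrite !inE; apply/norP => -[]; rewrite ![k == _]eq_sym => ki1 ki2.
  have := k3 k kD ki1; have := k3 i2 i2D i12.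
  by case: (two _ _ i2D kD ki2) => ->.
have [i1I xA1 [y1 xy1 B1]] := DP _ i1D; have [i2I xA2 [y2 xy2 B2]] := DP _ i2D.
have y2A1 : y2 \in A i1 by apply: (hit_pairr cr i2I i1I _ B2); rewrite // eq_sym.
have y1A2 : y1 \in A i2 by apply: (hit_pairr cr i1I i2I _ B1).
have y12 : y1 != y2.
  by have := cross1_notinB cr i1I y2A1; rewrite B1 !inE negb_or ![y2 == _]eq_sym => /andP [].
have [e ey2 Ae] := card2_mem a1 y2A1.
have ex : e != x by apply: contraNneq xA1 => <-; rewrite Ae !inE eqxx orbT.
(* Every member of [Q] avoids [x] in [A j], hence has [y1] and [y2] there, and therefore [e] in its
   [B j]. *)
pose Q := R :\: [set i1; i2].
have QP j : j \in Q -> [/\ j \in R, j \in I, x \notin A j, i1 != j & i2 != j].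
  rewrite !inE negb_or ![j == _]eq_sym => /andP [/andP [-> ->]] /andP [jI xA].
  by rewrite jI.
have crQ : cross Q A (delete x B) by apply: cross_sub (subsetDl _ _) crx.1.
have yQ j : j \in Q -> (y1 \in A j) && (y2 \in A j).
  case/QP => _ jI xA n1 n2.
  by rewrite (hit_pairr cr i1I jI n1 B1 xA) (hit_pairr cr i2I jI n2 B2 xA).
have eQ j : j \in Q -> e \in delete x B j.
  move=> jQ; have /andP [_ y2A] := yQ j jQ; have [_ jI xA n1 n2] := QP j jQ.
  by rewrite !inE ex (hit_pairl cr i1I jI n1 Ae) // (cross1_notinB cr).
have cov : R \subset [set i1] :|: ([set i2] :|: Q).
  by apply/subsetP => j jR; rewrite !in_setU !in_set1 in_setD jR !inE; case: (j == i1); case: (j == i2).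
have cB j : j \in D -> #|delete x B j| = 1%N by rewrite inE => /andP [_ /eqP].
have w1 : weight [set i1] A (delete x B) <= 1 / 3.
  by have [_ <- _ _ _] := wgt_values; apply: weight_pair_le; rewrite ?a1 ?cB.
have covw := weight_cover A (delete x B) cov.
have covw' := weightU [set i2] Q A (delete x B).
(* With [A i2] large the total is at most 1/3 + 1/4 + 1/5 < 5/6. *)
case: hi2 => [a2|[a3 D2]]; last first.
  apply: le_trans h _.
  have w2 : weight [set i2] A (delete x B) <= 1 / 4.
    by have [_ _ <- _ _] := wgt_values; apply: weight_pair_le; rewrite ?a3 ?cB.
  have wQ : weight Q A (delete x B) <= 1 / 5.
    apply: (weight_strip21 crQ y12 (w := e)) => j jQ.
    have /andP [-> ->] := yQ j jQ; split; rewrite ?eQ //.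
    have [jR _ _ n1 n2] := QP j jQ; rewrite ltn_neqAle Bx // andbT eq_sym.
    apply/negP => c1; have jD : j \in D by rewrite inE jR c1.
    by have := subsetP D2 j jD; rewrite !inE ![j == _]eq_sym (negPf n1) (negPf n2).
  by rewrite -/R; lra.
have [e' ey1 Ae'] := card2_mem a2 y1A2.
(* If [e = e'], the original system is bounded directly. Otherwise [Q] also has [e'] common to its
   [B j], and the total is at most 1/3 + 1/3 + 1/6 = 5/6. *)
have [Eee|ee] := eqVneq e e'.
  rewrite -Eee in Ae'.
  exact: (weight_le_twin cr sz i1I i2I i12 xy1 xy2 Ae B1 Ae' B2).
apply: le_trans h _.
have w2 : weight [set i2] A (delete x B) <= 1 / 3.
  by have [_ <- _ _ _] := wgt_values; apply: weight_pair_le; rewrite ?a2 ?cB.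
have e'x : e' != x by apply: contraNneq xA2 => <-; rewrite Ae' !inE eqxx orbT.
have e'Q j : j \in Q -> e' \in delete x B j.
  move=> jQ; have /andP [y1A _] := yQ j jQ; have [_ jI xA n1 n2] := QP j jQ.
  by rewrite !inE e'x (hit_pairl cr i2I jI n2 Ae') // (cross1_notinB cr).
have wQ : weight Q A (delete x B) <= 1 / 6.
  apply: (weight_strip22 crQ y12 ee) => j jQ.
  by have /andP [-> ->] := yQ j jQ; rewrite eQ ?e'Q.
by rewrite -/R; lra.
Qed.

(** * Systems that are heavy on both sides *)

(** If [x] were not in [A i3], then [A i3] = {y1, y2}, so [u] is one of these. As [A i4] contains
    [u], it cannot contain [x], so it also equals {y1, y2}. But then [A i4] cannot meet [B i3]. *)
Lemma heavy_center T X (I : {set T}) (A B : T -> {set X}) x y1 y2 u v w i1 i2 i3 i4 :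
  cross1 I A B -> i1 \in I -> i2 \in I -> i3 \in I -> i4 \in I ->
  i1 != i2 -> i3 != i4 -> i1 != i3 -> i1 != i4 -> i2 != i3 -> i2 != i4 ->
  B i1 = [set x; y1] -> B i2 = [set x; y2] -> x != y1 -> x != y2 ->
  A i3 = [set u; v] -> A i4 = [set u; w] ->
  x \in A i3.
Proof.
move=> cr i1I i2I i3I i4I i12 i34 i13 i14 i23 i24 B1 B2 xy1 xy2 A3 A4.
apply/negPn/negP => xA3.
have a1 := hit_pairr cr i1I i3I i13 B1 xA3; have a2 := hit_pairr cr i2I i3I i23 B2 xA3.
have y12 : y1 != y2.
  have xA1 : x \notin A i1 by rewrite (cross1_notinA cr) // B1 !inE eqxx.
  have y2A1 : y2 \in A i1 by apply: (hit_pairr cr i2I i1I _ B2); rewrite // eq_sym.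
  by have := cross1_notinB cr i1I y2A1; rewrite B1 !inE negb_or ![y2 == _]eq_sym => /andP [].
have uA3 : u \in A i3 by rewrite A3 !inE eqxx.
have uA4 : u \in A i4 by rewrite A4 !inE eqxx.
have uy : (u == y1) || (u == y2).
  move: a1 a2; rewrite A3 !inE ![_ == u]eq_sym.
  case: (u == y1) => //=; case: (u == y2) => //= /eqP E1 /eqP E2.
  by rewrite E1 E2 eqxx in y12.
have xA4 : x \notin A i4.
  apply: contraL uA4 => xA4.
  have n1 := hit_pairr_uniq cr i1I i4I i14 B1 xy1 xA4.
  have n2 := hit_pairr_uniq cr i2I i4I i24 B2 xy2 xA4.
  by case/orP: uy => /eqP ->.
have b1 := hit_pairr cr i1I i4I i14 B1 xA4; have b2 := hit_pairr cr i2I i4I i24 B2 xA4.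
have wB3 : w \in B i3.
  by apply: (hit_pairl cr i4I i3I _ A4); rewrite ?(cross1_notinB cr) // eq_sym.
have wA3 : w \in A i3.
  move: b1 b2; rewrite A4 !inE => /orP [/eqP E1|/eqP <- //] /orP [/eqP E2|/eqP <- //].
  by rewrite E1 E2 eqxx in y12.
by have := cross1_notinB cr i3I wA3; rewrite wB3.
Qed.

(** The four given pairs weigh at most 1/10 each, and the others split by whether [x] is in [B j]
    into [L] and [K] of weight at most 1/5 each; the total is at most 4/5. *)
Lemma weight_le_heavy_aux T X (I : {set T}) (A B : T -> {set X})
    x y1 y2 v1 v2 i1 i2 i3 i4 :
  cross1 I A B -> (forall i, i \in I -> (2 <= #|A i|)%N /\ (2 <= #|B i|)%N) ->
  [/\ i1 \in I, i2 \in I, i3 \in I & i4 \in I] ->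
  y1 != y2 -> v1 != v2 ->
  B i1 = [set x; y1] -> B i2 = [set x; y2] ->
  A i3 = [set x; v1] -> A i4 = [set x; v2] ->
  (3 <= #|A i1|)%N -> (3 <= #|A i2|)%N -> (3 <= #|B i3|)%N -> (3 <= #|B i4|)%N ->
  (forall j, j \in I -> j \notin [set i1; i2; i3; i4] -> x \in A j ->
     (y1 \notin B j) && (y2 \notin B j)) ->
  weight I A B <= 5 / 6.
Proof.
move=> cr sz [i1I i2I i3I i4I] y12 v12 B1 B2 A3 A4 s1 s2 s3 s4 nyB.
pose J := I :\: [set i1; i2; i3; i4].
have JI j : j \in J -> [/\ j \in I, i1 != j, i2 != j, i3 != j & i4 != j].
  rewrite !inE !negb_or ![_ == j]eq_sym => /andP [/andP [/andP [/andP [-> ->] ->] ->] ->].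
  by [].
have yA j : j \in J -> x \notin A j -> (y1 \in A j) && (y2 \in A j).
  by case/JI => jI j1 j2 _ _ xA; rewrite (hit_pairr cr i1I jI j1 B1 xA) (hit_pairr cr i2I jI j2 B2 xA).
have vB j : j \in J -> x \notin B j -> (v1 \in B j) && (v2 \in B j).
  by case/JI => jI _ _ j3 j4 xB; rewrite (hit_pairl cr i3I jI j3 A3 xB) (hit_pairl cr i4I jI j4 A4 xB).
pose K := [set j in J | x \notin B j]; pose L := [set j in J | x \in B j].
have w3 i : i \in I -> (3 <= #|A i|)%N -> weight [set i] A B <= 1 / 10.
  move=> iI s; have [_ _ _ _ <-] := wgt_values.
  by apply: weight_pair_le => //; case: (sz i iI).
have w3' i : i \in I -> (3 <= #|B i|)%N -> weight [set i] A B <= 1 / 10.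
  move=> iI s; have [_ _ _ _ <-] := wgt_values; rewrite wgtC.
  by apply: weight_pair_le => //; case: (sz i iI).
have wL : weight L A B <= 1 / 5.
  apply: (weight_strip21 _ y12 (w := x)) => [|j].
    apply: cross_sub cr.1; apply/subsetP => j; rewrite inE => /andP [+ _].
    by case/JI.
  rewrite inE => /andP [jJ xB]; have [jI _ _ _ _] := JI j jJ.
  have /andP [-> ->] := yA j jJ (cross1_notinA cr jI xB).
  by case: (sz j jI).
have wK : weight K A B <= 1 / 5.
  (* No element of U i or of {v1, v2} can be a common element of A i and B j, so K
     can be stripped as a single family. *)
  pose U j := if x \in A j then [set x] else [set y1; y2].
  have KP j : j \in K -> [/\ j \in J, x \notin B j, U j \subset A j & [set v1; v2] \subset B j].
    rewrite inE => /andP [jJ xB]; split=> //; last first.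
      by have /andP [a b] := vB j jJ xB; rewrite subUset !sub1set a b.
    rewrite /U; case: ifP => xA; first by rewrite sub1set.
    by have /andP [a b] := yA j jJ (negbT xA); rewrite subUset !sub1set a b.
  apply: (weight_le_cross (divr_ge0 ler01 (ler0n _ 5))
    (A' := fun j => A j :\: U j) (B' := fun j => B j :\: [set v1; v2])).
    split=> [i z iK|i j iK jK ij].
      have [/JI [iI _ _ _ _] _ _ _] := KP i iK.
      by rewrite !inE => /andP [_ /(cross1_notinB cr iI) /negbTE ->]; rewrite andbF.
    have [iJ xBi _ /subsetP vBi] := KP i iK; have [jJ xBj _ _] := KP j jK.
    have [[iI _ _ _ _] [jI _ _ _ _]] := (JI i iJ, JI j jJ).
    have [z zA zB] := cr.1.2 i j iI jI ij; exists z; rewrite inE ?zA ?zB andbT.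
      rewrite /U; case: ifP => xA; first by rewrite inE; apply: contraNneq xBj => <-.
      (* If [x] is in [A j] this is the last hypothesis; otherwise [y1] and [y2] are in [A j], hence
         not in [B j]. *)
      have /andP [n1 n2] : (y1 \notin B j) && (y2 \notin B j).
        case xAj: (x \in A j); first by apply: nyB => //; move: jJ; rewrite inE => /andP [].
        have /andP [a b] := yA j jJ (negbT xAj).
        by rewrite !(cross1_notinB cr jI).
      rewrite !inE negb_or; apply/andP; split; first by apply: contraNneq n1 => <-.
      by apply: contraNneq n2 => <-.
    by apply: contraL zA => /vBi; apply: (cross1_notinA cr iI).
  move=> j jK; have [jJ _ UA VB] := KP j jK; have [jI _ _ _ _] := JI j jJ.
  have := subset_leq_card VB; have := subset_leq_card UA.
  rewrite (cardsDS UA) (cardsDS VB) /U cards2 v12 /=; case: ifP => xA.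
    rewrite cards1 => _ /subnK <-; case: (sz j jI) => /subnK <- _.
    rewrite !addn2 subn1 !subn2; exact: wgt_strip12.
  rewrite cards2 y12 /= => /subnK <- /subnK <-; rewrite !addn2 !subn2.
  apply: le_trans (wgt_strip22 _ _) _; apply: ler_wpM2r; first exact: wgt_ge0.
  lra.
have cov : I \subset [set i1] :|: ([set i2] :|: ([set i3] :|: ([set i4] :|: (K :|: L)))).
  apply/subsetP => j jI; case: (boolP (j \in J)) => jJ; last first.
    move: jJ; rewrite !inE jI andbT negbK -!orbA.
    by case/or4P => ->; rewrite ?orbT.
  by rewrite !in_setU [j \in K]inE [j \in L]inE jJ /= orNb !orbT.
have := weight_cover A B cov.
have := weightU [set i2] ([set i3] :|: ([set i4] :|: (K :|: L))) A B.
have := weightU [set i3] ([set i4] :|: (K :|: L)) A B.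
have := weightU [set i4] (K :|: L) A B.
have := weightU K L A B.
have := w3 i1 i1I s1; have := w3 i2 i2I s2; have := w3' i3 i3I s3; have := w3' i4 i4I s4.
lra.
Qed.

(** The four indices are distinct by size, and [heavy_center] identifies the two centres. The
    auxiliary bound then applies to the system or to its exchange. *)
Lemma weight_le_heavy T X (I : {set T}) (A B : T -> {set X}) :
  cross1 I A B -> (forall i, i \in I -> (2 <= #|A i|)%N /\ (2 <= #|B i|)%N) ->
  heavy I A B -> heavy I B A -> weight I A B <= 5 / 6.
Proof.
move=> cr sz [x [y1 [y2 [i1 [i2 [[i1I i2I i12] [B1 B2 xy1 xy2 [s1 s2]]]]]]]].
move=> [u [v1 [v2 [i3 [i4 [[i3I i4I i34] [A3 A4 uv1 uv2 [s3 s4]]]]]]]].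
have lt_neq i j : (3 <= #|A i|)%N -> #|A j| = 2 -> i != j.
  by move=> s sj; apply: contraTneq s => ->; rewrite sj.
have c3 : #|A i3| = 2 by rewrite A3 cards2 uv1.
have c4 : #|A i4| = 2 by rewrite A4 cards2 uv2.
have [i13 i14 i23 i24] : [/\ i1 != i3, i1 != i4, i2 != i3 & i2 != i4] by split; apply: lt_neq.
have i43 : i4 != i3 by rewrite eq_sym.
have xA3 : x \in A i3.
  exact: (heavy_center cr i1I i2I i3I i4I i12 i34 i13 i14 i23 i24 B1 B2 xy1 xy2 A3 A4).
have xA4 : x \in A i4.
  exact: (heavy_center cr i1I i2I i4I i3I i12 i43 i14 i13 i24 i23 B1 B2 xy1 xy2 A4 A3).
have v2B3 : v2 \in B i3.
  by apply: (hit_pairl cr i4I i3I i43 A4); rewrite (cross1_notinB cr) // A3 !inE eqxx.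
have v12 : v1 != v2.
  by apply: contraTneq v2B3 => <-; rewrite (cross1_notinB cr) // A3 !inE eqxx orbT.
have xA1 : x \notin A i1 by rewrite (cross1_notinA cr) // B1 !inE eqxx.
have y2A1 : y2 \in A i1 by apply: (hit_pairr cr i2I i1I _ B2); rewrite // eq_sym.
have y12 : y1 != y2.
  by have := cross1_notinB cr i1I y2A1; rewrite B1 !inE negb_or ![y2 == _]eq_sym => /andP [].
have Eu : u = x.
  move: xA3 xA4; rewrite A3 A4 !inE => /orP [/eqP -> //|/eqP ->] /orP [/eqP -> //|/eqP E].
  by rewrite E eqxx in v12.
subst u.
(* A pair with x in A j and some y in B j, and a pair with x in B k and some v
   in A k, would meet twice; so one of the two kinds is absent. *)
have [/exists_inP [j jI /and3P [jn xA yB]]|no] := boolP [exists j in I,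
  [&& j \notin [set i1; i2; i3; i4], x \in A j & (y1 \in B j) || (y2 \in B j)]]; last first.
  apply: (weight_le_heavy_aux cr sz _ y12 v12 B1 B2 A3 A4) => // j jI jn xA.
  rewrite -negb_or; apply: contra no => yB; apply/exists_inP; exists j => //.
  by rewrite jn xA yB.
rewrite weightC.
have En : [set i3; i4; i1; i2] = [set i1; i2; i3; i4].
  by apply/setP => k; rewrite !inE; do 4 case: (_ == _).
apply: (weight_le_heavy_aux (cross1C cr) _ _ v12 y12 A3 A4 B1 B2) => //.
  by move=> i /sz [].
move=> k kI; rewrite En => kn xB; rewrite -negb_or; apply/negP => vA.
have [k1 k2] : i1 != k /\ i2 != k.
  by move: kn; rewrite !inE !negb_or ![k == _]eq_sym -!andbA => /and4P [].
have xAk := cross1_notinA cr kI xB.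
have y1A := hit_pairr cr i1I kI k1 B1 xAk; have y2A := hit_pairr cr i2I kI k2 B2 xAk.
have [j3 j4] : i3 != j /\ i4 != j.
  by move: jn; rewrite !inE !negb_or ![j == _]eq_sym -!andbA => /and4P [].
have xBj := cross1_notinB cr jI xA.
have v1B := hit_pairl cr i3I jI j3 A3 xBj; have v2B := hit_pairl cr i4I jI j4 A4 xBj.
have kj : k != j by apply: contraNneq xBj => <-.
(* Both [y] and [v] are common to [A k] and [B j]. They differ because [A i3] and [A i4] contain
   [x], hence neither [y1] nor [y2], whereas [v] lies in one of them. *)
have [y [yB' yA' yA3 yA4]] : exists y, [/\ y \in B j, y \in A k, y \notin A i3 & y \notin A i4].
  case/orP: yB => yB; [exists y1|exists y2]; split=> //.
  - exact: (hit_pairr_uniq cr i1I i3I i13 B1).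
  - exact: (hit_pairr_uniq cr i1I i4I i14 B1).
  - exact: (hit_pairr_uniq cr i2I i3I i23 B2).
  - exact: (hit_pairr_uniq cr i2I i4I i24 B2).
have [v [vB' vA' vA34]] : exists v, [/\ v \in B j, v \in A k & (v \in A i3) || (v \in A i4)].
  by case/orP: vA => vA; [exists v1|exists v2]; rewrite ?A3 ?A4 !inE ?eqxx ?orbT.
have Eyv : y = v by apply: (cr.2 k j).
by move: vA34; rewrite -Eyv (negPf yA3) (negPf yA4).
Qed.

Theorem weight_le T X n : bounded_below n T X.
Proof.
elim: n => // n IH I A B; rewrite ltnS => sn cr A2 B1 uniq1.
have IHs : bounded_below (total_size I A B) T X.
  by move=> J A' B' s; apply: IH; apply: leq_trans s sn.
have [/exists_inP [i0 i0I /eqP Bi0]|no1] := boolP [exists i in I, #|B i| == 1%N].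
  apply: (weight_le_singleton IHs cr A2 i0I Bi0) => i iI ii0.
  rewrite ltn_neqAle B1 // andbT eq_sym; apply: contra ii0 => /eqP Bi.
  by rewrite (uniq1 i i0).
have sz i : i \in I -> (2 <= #|A i|)%N /\ (2 <= #|B i|)%N.
  move=> iI; split; first exact: A2.
  rewrite ltn_neqAle B1 // andbT eq_sym; apply: contra no1 => Bi.
  by apply/exists_inP; exists i.
have [//|hB] := weight_le_or_heavy IHs cr sz.
(* With all sets of size at least two the assumptions are symmetric, so the dichotomy also holds
   with [A] and [B] exchanged. *)
have szC i : i \in I -> (2 <= #|B i|)%N /\ (2 <= #|A i|)%N by case/sz.
have IHsC : bounded_below (total_size I B A) T X by rewrite total_sizeC.
have [|hA] := weight_le_or_heavy IHsC (cross1C cr) szC; first by rewrite weightC.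
exact: weight_le_heavy.
Qed.

(** * Padding to sets of size at least two *)

Local Open Scope fset_scope.
Local Open Scope ring_scope.

(* The flag c keeps the dummy elements of the A i apart from those of the B i. *)
Definition pad (K : choiceType) (m : nat) (U : {fset K}) (c : bool)
    (A : 'I_m -> {fset K}) (i : 'I_m) : {set U + 'I_m * bool * 'I_2} :=
  (inl @: fsub U (A i)) :|:
  (inr @: ((fun n : 'I_2 => (i, c, n)) @: [set n : 'I_2 | (n < 2 - #|` A i|)%N])).

Lemma pad_inl (K : choiceType) (m : nat) (U : {fset K}) c (A : 'I_m -> {fset K}) i (k : U) :
  (inl k \in pad U c A i) = (val k \in A i).
Proof.
rewrite inE mem_imset ?in_fsub; last by move=> ? ? [].
suff -> : inl k \in inr @: _ = false by rewrite orbF.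
by move=> T T' S; apply/negP => /imsetP [].
Qed.

Lemma pad_inr (K : choiceType) (m : nat) (U : {fset K}) c (A : 'I_m -> {fset K}) i j d n :
  inr (j, d, n) \in pad U c A i -> d = c.
Proof. by rewrite inE => /orP [] /imsetP [] // _ /imsetP [n' _ ->] [_ -> _]. Qed.

Lemma card_pad (K : choiceType) (m : nat) (U : {fset K}) c (A : 'I_m -> {fset K}) i :
  A i `<=` U -> #|pad U c A i| = maxn 2 #|` A i|.
Proof.
move=> AU; rewrite cardsU.
have -> : (inl @: fsub U (A i)) :&:
    (inr @: ((fun n : 'I_2 => (i, c, n)) @: [set n : 'I_2 | (n < 2 - #|` A i|)%N])) = set0.
  by apply/setP => x; rewrite !inE; apply/negP => /andP [/imsetP [? _ ->] /imsetP []].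
rewrite cards0 subn0 !card_imset; [|by move=> ? ? []..].
rewrite card_fsub //; have -> : #|[set n : 'I_2 | (n < 2 - #|` A i|)%N]| = (2 - #|` A i|)%N.
  rewrite -sum1_card big_mkcond !big_ord_recl big_ord0 !inE /=.
  by case: #|` A i| => [|[|k]].
by rewrite maxnE addnC; case: #|` A i| => [|[|k]] //=; lia.
Qed.

(** Padding creates no new intersections, and since [a i] and [b i] are at least 2 the padded sizes
    still respect them, so monotonicity of [wgt] gives the bound. *)
Lemma sum_wgt_le (K : choiceType) (m : nat) (a b : 'I_m -> nat) (A B : 'I_m -> {fset K}) :
  (forall i, (2 <= a i)%N /\ (2 <= b i)%N) ->
  one_cross_intersecting A B ->
  (forall i, (#|` A i| <= a i)%N /\ (#|` B i| <= b i)%N) ->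
  \sum_(i < m) ('C(a i + b i, a i)%:R : rat)^-1 <= 5%:R / 6%:R.
Proof.
move=> ab2 [_ dis one] le.
(* The union of all sets supplies the finite ground type needed for averaging. *)
pose U := (\bigcup_(i <- enum 'I_m) (A i `|` B i))%fset.
have ABU i : A i `|` B i `<=` U by apply: bigfcup_sup; rewrite ?mem_enum.
have AU i : A i `<=` U by apply: fsubset_trans (fsubsetUl _ _) (ABU i).
have BU i : B i `<=` U by apply: fsubset_trans (fsubsetUr _ _) (ABU i).
pose A' := pad U false A; pose B' := pad U true B.
have cr : cross1 setT A' B'.
  split; [split|].
  - move=> i [k|[[j c] n]] _; last by move=> /pad_inr ->; apply/negP => /pad_inr.
    rewrite !pad_inl => kA; apply/negP => kB.
    by have /fsetP /(_ (val k)) := dis i; rewrite !inE kA kB.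
  - move=> i j _ _ ij; have /eqP /cardfs1P [z /fsetP /(_ z)] := one i j ij.
    rewrite !inE eqxx => /andP [zA zB].
    by exists (inl [` fsubsetP (AU i) z zA]); rewrite pad_inl.
  - move=> i j [k|[[i1 c] n]] [l|[[i2 d] n']] _ _ ij; rewrite ?pad_inl; last first.
    + by move=> /pad_inr -> /pad_inr.
    + by move=> /pad_inr -> /pad_inr.
    + by move=> _ _ /pad_inr -> /pad_inr.
    move=> kA kB lA lB; congr inl; apply: val_inj.
    have /eqP /cardfs1P [z /fsetP hz] := one i j ij.
    have := hz (val k); have := hz (val l); rewrite !inE kA kB lA lB /=.
    by move=> /esym /eqP -> /esym /eqP ->.
have sA i : #|A' i| = maxn 2 #|` A i| by apply: card_pad.
have sB i : #|B' i| = maxn 2 #|` B i| by apply: card_pad.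
have h : weight setT A' B' <= 5 / 6.
  apply: (weight_le (leqnn _) cr) => [i|i|i j] _; rewrite ?sA ?sB.
  - by rewrite leq_maxl.
  - by rewrite leq_max.
  (* Vacuous, since a padded set is never a singleton. *)
  - by move=> _ /eqP; rewrite eqn_leq geq_max.
apply: le_trans h; rewrite /weight.
rewrite [leRHS](eq_bigl xpredT); last by move=> i; rewrite inE.
apply: ler_sum => i _; rewrite -wgtE wgt_le // ?sA ?sB geq_max.
  by case: (ab2 i) (le i) => -> _ [].
by case: (ab2 i) (le i) => _ -> [].
Qed.

Lemma size_le (K : choiceType) (a b m : nat) (A B : 'I_m -> {fset K}) :
  (2 <= a)%N -> (2 <= b)%N -> one_cross_intersecting A B ->
  (forall i, (#|` A i| <= a)%N /\ (#|` B i| <= b)%N) ->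
  m%:R <= 5%:R / 6%:R * 'C(a + b, a)%:R :> rat.
Proof.
move=> a2 b2 cr le; have := @sum_wgt_le K m (fun=> a) (fun=> b) A B (fun=> conj a2 b2) cr le.
rewrite sumr_const card_ord -[_ *+ m]mulr_natl ler_pdivrMr // ltr0n bin_gt0.
exact: leq_addr.
Qed.

(** * Existence of the maximum *)

(** Induction on the distance to the bound; excluded middle decides whether a larger value exists,
    as [P] need not be decidable. *)
Lemma bounded_max (P : nat -> Prop) (m N : nat) :
  P m -> (forall k, P k -> (k <= N)%N) -> exists2 M, P M & forall k, P k -> (k <= M)%N.
Proof.
move=> Pm leN; have [d] := ubnP (N - m)%N; elim: d m Pm => // d IH m Pm dm.
case: (classic (exists2 k, P k & (m < k)%N)) => [[k Pk mk]|no].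
  by apply: (IH k Pk); have := leN k Pk; lia.
by exists m => // k Pk; rewrite leqNgt; apply/negP => mk; apply: no; exists k.
Qed.

(** The pairs ({true}, {false}) and ({false}, {true}) show that the maximum is over a nonempty
    set. *)
Lemma has_bounded_system2 a b : (2 <= a)%N -> (2 <= b)%N -> has_bounded_system a b 2.
Proof.
move=> a2 b2; exists bool, (fun i => [fset i == ord0]), (fun i => [fset i != ord0]).
split; last by move=> i; rewrite !cardfs1; split; apply: ltnW.
split=> // [i|i j ij].
  by apply/fsetP => x; rewrite !inE; case: (i == ord0); case: x.
apply/eqP/cardfs1P; exists (i == ord0); apply/fsetP => x; rewrite !inE.
by move: i j ij x => [[|[|i]] hi] [[|[|j]] hj] //= _ [].
Qed.

Theorem theorem1p5 :
  (forall (K : choiceType) (m : nat) (a b : 'I_m -> nat) (A B : 'I_m -> {fset K}),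
     (2 <= m)%N ->
     (forall i, (2 <= a i)%N /\ (2 <= b i)%N) ->
     one_cross_intersecting A B ->
     (forall i, (#|` A i| <= a i)%N /\ (#|` B i| <= b i)%N) ->
     \sum_(i < m) ('C(a i + b i, a i)%:R : rat)^-1 <= 5%:R / 6%:R) /\
  (forall a b : nat, (2 <= a)%N -> (2 <= b)%N ->
     (forall (K : choiceType) (m : nat) (A B : 'I_m -> {fset K}),
        one_cross_intersecting A B ->
        (forall i, (#|` A i| <= a)%N /\ (#|` B i| <= b)%N) ->
        m%:R <= 5%:R / 6%:R * 'C(a + b, a)%:R :> rat) /\
     (exists2 M : nat, is_max_system_size a b M
        & M%:R <= 5%:R / 6%:R * 'C(a + b, a)%:R :> rat)).
Proof.
split=> [K m a b A B _|a b a2 b2]; first exact: sum_wgt_le.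
have le m : has_bounded_system a b m -> m%:R <= 5%:R / 6%:R * 'C(a + b, a)%:R :> rat.
  by case=> K [A [B [cr s]]]; apply: size_le cr s.
split=> [K m A B|]; first exact: size_le.
(* For existence any natural bound serves; the binomial coefficient without 5/6 is one. *)
have [|M PM maxM] := @bounded_max _ 2 'C(a + b, a) (has_bounded_system2 a2 b2).
  move=> m /le; have : 0 <= 'C(a + b, a)%:R :> rat by apply: ler0n.
  by rewrite -(ler_nat rat); lra.
by exists M; [split|apply: le].
Qed.
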